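(* Let $p$ be a prime, let $0 \leq m \leq p-1$ and let $r\geq (m+1)(p+1)-1$. Then we have the following explicit isomorphisms of representations of $G(\mathbb{F}_p)=\mathrm{GL}_2(\mathbb{F}_p)$ over $\mathbb{F}_p$: (1) If $p \nmid \binom{r}{m}$, then $$\frac{V_r}{V_r^{(m+1)}} \simeq \mathrm{ind}_{B(\mathbb{F}_p)}^{G(\mathbb{F}_p)} ( V_m \otimes d^{\,r-m} ),$$ where $V_m$ is the representation of $B(\mathbb{F}_p)$ obtained by restriction from $G(\mathbb{F}_p)$. (2) If $p \mid \binom{r}{m}$ and $m = 1$, then $$\frac{V_r}{V_r^{(2)}} \simeq \mathrm{ind}_{B(\mathbb{F}_p)}^{G(\mathbb{F}_p)} ( V_1^{\mathrm{ss}} \otimes d^{\,r-1} ),$$ where $V_1^{\mathrm{ss}}$ is the split representation of $B(\mathbb{F}_p)$ obtained as the semi-simplification of $V_1$.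
   Context: $G(\mathbb{F}_p)=\mathrm{GL}_2(\mathbb{F}_p)$ and $B(\mathbb{F}_p)$ is its subgroup of upper triangular matrices. For $r\ge 0$, $V_r$ is the $r$-th symmetric power of the standard two-dimensional representation of $G(\mathbb{F}_p)$ over $\mathbb{F}_p$, identified with homogeneous polynomials $P(X,Y)$ of degree $r$ over $\mathbb{F}_p$, with action $\begin{pmatrix} a & b\\ c & d\end{pmatrix}\cdot P(X,Y)=P(aX+cY,bX+dY)$. Let $\theta=X^pY-XY^p$; for $m\ge 0$, $V_r^{(m+1)}$ is the subrepresentation of $V_r$ consisting of the polynomials divisible by $\theta^{m+1}$. For an integer $s$, $d^s$ denotes the character $\begin{pmatrix} a & b\\ 0 & d\end{pmatrix}\mapsto d^s$ of $B(\mathbb{F}_p)$; similarly $a$ and $d$ denote the characters of $B(\mathbb{F}_p)$ sending this matrix to $a$ and to $d$, so that $V_1^{\mathrm{ss}}=a\oplus d$. For a representation $\sigma$ of a subgroup $H$ of a finite group $G$, $\mathrm{ind}_H^G\sigma$ is the space of functions $f:G\to\sigma$ with $f(hg)=\sigma(h)f(g)$ for $h\in H$, $g \in G$, with $G$ acting by right translation, $(g\cdot f)(g')=f(g'g)$. *)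

(* Defs.v *)
From HB Require Import structures.
From mathcomp Require Import all_boot all_algebra all_fingroup.
From mathcomp Require Import boolp mpoly ring.

Set Implicit Arguments.
Unset Strict Implicit.
Unset Printing Implicit Defensive.

Import GRing.Theory.

Local Open Scope ring_scope.
Local Open Scope quotient_scope.

(* Left linear representations of a finite group H on an F-module. As for the
   mx_representation of the library, the action is a function on the whole
   ambient type gT and only its values on H matter. *)
Record lrep (F : fieldType) (gT : finGroupType) (H : {set gT}) := LRep {
  lrep_sort :> lmodType F;
  lact : gT -> lrep_sort -> lrep_sort;
  lact_linear : forall g, g \in H -> linear (lact g);
  lact1 : forall v, lact 1%g v = v;
  lactM : {in H &, forall g h v, lact (g * h)%g v = lact g (lact h v)}
}.

Section LinearAction.
Variables (F : fieldType) (gT : finGroupType) (H : {set gT}) (rho : lrep F H).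
Variables (g : gT) (Hg : g \in H).

Lemma lactD (u v : rho) : lact g (u + v) = lact g u + lact g v.
Proof. by have := lact_linear Hg 1 u v; rewrite !scale1r. Qed.

Lemma lact0 : lact g (0 : rho) = 0.
Proof. by apply: (addrI (lact g 0)); rewrite -lactD !addr0. Qed.

Lemma lactZ a (v : rho) : lact g (a *: v) = a *: lact g v.
Proof. by have := lact_linear Hg a v 0; rewrite lact0 !addr0. Qed.

Lemma lactB (u v : rho) : lact g (u - v) = lact g u - lact g v.
Proof. by rewrite lactD -scaleN1r lactZ scaleN1r. Qed.
End LinearAction.

Definition lrep_iso (F : fieldType) (gT : finGroupType) (H : {set gT})
    (rho sigma : lrep F H) : Prop :=
  exists2 f : {linear rho -> sigma}, bijective f &
    {in H, forall g (v : rho), f (lact g v) = lact g (f v)}.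

Record lchar (F : fieldType) (gT : finGroupType) (H : {set gT}) := LChar {
  lchar_fun :> gT -> F;
  lchar1 : lchar_fun 1%g = 1;
  lcharM : {in H &, forall g h, lchar_fun (g * h)%g = lchar_fun g * lchar_fun h}
}.

Section Constructions.
Variables (F : fieldType) (gT : finGroupType).

Section Restriction.
Variables (G H : {set gT}) (sHG : H \subset G) (rho : lrep F G).

Lemma res_linear g : g \in H -> linear (lact (l := rho) g).
Proof. by move=> /(subsetP sHG)/lact_linear. Qed.

Lemma res_actM :
  {in H &, forall g h v, lact (l := rho) (g * h)%g v = lact g (lact h v)}.
Proof. by move=> g h /(subsetP sHG) Gg /(subsetP sHG) Gh v; rewrite lactM. Qed.

Definition res_rep : lrep F H := LRep res_linear (lact1 (l := rho)) res_actM.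
End Restriction.

Section Character.
Variables (H : {set gT}) (chi : lchar F H).

Definition char_act (g : gT) (v : F^o) : F^o := chi g * v.

Lemma char_linear g : g \in H -> linear (char_act g).
Proof. by move=> _ a u v; rewrite /char_act mulrDr /GRing.scale /= mulrCA. Qed.

Lemma char_act1 v : char_act 1%g v = v.
Proof. by rewrite /char_act lchar1 mul1r. Qed.

Lemma char_actM :
  {in H &, forall g h v, char_act (g * h)%g v = char_act g (char_act h v)}.
Proof. by move=> g h Hg Hh v; rewrite /char_act lcharM // mulrA. Qed.

Definition char_rep : lrep F H := LRep char_linear char_act1 char_actM.
End Character.

(* The tensor product of sigma with a one-dimensional character chi, carried
   by the space of sigma. *)
Section Twist.
Variables (H : {set gT}) (sigma : lrep F H) (chi : lchar F H).

Definition twist_act (g : gT) (v : sigma) : sigma := chi g *: lact g v.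

Lemma twist_linear g : g \in H -> linear (twist_act g).
Proof.
move=> Hg a u v; rewrite /twist_act lact_linear // scalerDr !scalerA.
by rewrite mulrC.
Qed.

Lemma twist_act1 v : twist_act 1%g v = v.
Proof. by rewrite /twist_act lchar1 lact1 scale1r. Qed.

Lemma twist_actM :
  {in H &, forall g h v, twist_act (g * h)%g v = twist_act g (twist_act h v)}.
Proof.
by move=> g h Hg Hh v; rewrite /twist_act lcharM // lactM // lactZ // scalerA.
Qed.

Definition twist_rep : lrep F H := LRep twist_linear twist_act1 twist_actM.
End Twist.

Section DirectSum.
Variables (H : {set gT}) (rho sigma : lrep F H).

Definition dsum_act (g : gT) (v : rho * sigma) : rho * sigma :=
  (lact g v.1, lact g v.2).

Lemma dsum_linear g : g \in H -> linear (dsum_act g).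
Proof. by move=> Hg a u v; rewrite /dsum_act /= !lact_linear. Qed.

Lemma dsum_act1 v : dsum_act 1%g v = v.
Proof. by rewrite /dsum_act !lact1; case: v. Qed.

Lemma dsum_actM :
  {in H &, forall g h v, dsum_act (g * h)%g v = dsum_act g (dsum_act h v)}.
Proof. by move=> g h Hg Hh v; rewrite /dsum_act !lactM. Qed.

Definition dsum_rep : lrep F H := LRep dsum_linear dsum_act1 dsum_actM.
End DirectSum.

Section Induction.
Variables (H : {set gT}) (sigma : lrep F H).

Definition ind_pred : {pred {ffun gT -> sigma}} :=
  fun f => [forall h in H, forall g, f (h * g)%g == lact h (f g)].

Lemma ind_predP (f : {ffun gT -> sigma}) :
  reflect {in H, forall h g, f (h * g)%g = lact h (f g)} (f \in ind_pred).
Proof.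
apply: (iffP forall_inP) => [fP h Hh g|fP h Hh].
  by move/forallP/(_ g)/eqP: (fP h Hh).
by apply/forallP=> g; rewrite fP.
Qed.

Lemma ind_pred_closed : submod_closed ind_pred.
Proof.
split=> [|a u v /ind_predP uP /ind_predP vP]; apply/ind_predP => h Hh g.
  by rewrite !ffunE lact0.
by rewrite !ffunE uP // vP // lact_linear.
Qed.

HB.instance Definition _ :=
  GRing.isSubmodClosed.Build F {ffun gT -> sigma} ind_pred ind_pred_closed.

Record induced := Induced {
  ind_fun :> {ffun gT -> sigma};
  ind_funP : ind_fun \in ind_pred
}.

HB.instance Definition _ := [isSub for ind_fun].
HB.instance Definition _ := [Choice of induced by <:].
HB.instance Definition _ := [SubChoice_isSubLmodule of induced by <:].

Lemma rtrans_subproof (g : gT) (f : induced) :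
  [ffun g' => f (g' * g)%g] \in ind_pred.
Proof.
by apply/ind_predP => h Hh g'; rewrite !ffunE -mulgA (ind_predP _ (ind_funP f)).
Qed.

Definition ind_act (g : gT) (f : induced) : induced :=
  Induced (rtrans_subproof g f).

Lemma ind_linear g : g \in [set: gT] -> linear (ind_act g).
Proof.
by move=> _ a u v; apply/val_inj/ffunP=> x; rewrite /= !ffunE.
Qed.

Lemma ind_act1 f : ind_act 1%g f = f.
Proof. by apply/val_inj/ffunP=> x; rewrite /= !ffunE mulg1. Qed.

Lemma ind_actM : {in [set: gT] &, forall g h f,
  ind_act (g * h)%g f = ind_act g (ind_act h f)}.
Proof.
by move=> g h _ _ f; apply/val_inj/ffunP=> x; rewrite /= !ffunE mulgA.
Qed.

Definition ind_rep : lrep F [set: gT] := LRep ind_linear ind_act1 ind_actM.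
End Induction.

Section Quotient.
Variables (H : {set gT}) (rho : lrep F H).

Record subrep := SubRep {
  subrep_pred : {pred rho};
  subrep_closed : submod_closed subrep_pred;
  subrep_stable : {in H, forall g, {homo lact g : v / v \in subrep_pred}}
}.

Variable U : subrep.

HB.instance Definition _ :=
  GRing.isSubmodClosed.Build F rho (subrep_pred U) (subrep_closed U).

Definition quot_sort := {ideal_quot (subrep_pred U)}.
HB.instance Definition _ := GRing.Zmodule.on quot_sort.
HB.instance Definition _ := EqQuotient.on quot_sort.

Lemma quot_eqE (u v : rho) :
  (\pi_quot_sort u = \pi_quot_sort v) <-> u - v \in subrep_pred U.
Proof. by rewrite Quotient.idealrBE; split=> [/eqP|/eqP]. Qed.

Lemma quot_piD (u v : rho) :
  \pi_quot_sort (u + v) = \pi_quot_sort u + \pi_quot_sort v.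
Proof. exact: raddfD. Qed.

Definition quot_scale (a : F) (x : quot_sort) : quot_sort :=
  \pi_quot_sort (a *: generic_quotient.repr x).

Lemma quot_piZ a (u : rho) :
  quot_scale a (\pi_quot_sort u) = \pi_quot_sort (a *: u).
Proof.
apply/quot_eqE; rewrite -scalerBr rpredZ //; apply/quot_eqE.
exact: reprK.
Qed.

Lemma quot_scaleA a b x : quot_scale a (quot_scale b x) = quot_scale (a * b) x.
Proof. by rewrite quot_piZ scalerA. Qed.

Lemma quot_scale1 : left_id 1 quot_scale.
Proof. by move=> x; rewrite /quot_scale scale1r; exact: reprK. Qed.

Lemma quot_scaleDr : right_distributive quot_scale +%R.
Proof.
move=> a x y; rewrite -[x in LHS]reprK -[y in LHS]reprK -quot_piD quot_piZ.
by rewrite scalerDr quot_piD.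
Qed.

Lemma quot_scaleDl x : {morph quot_scale^~ x : a b / a + b}.
Proof. by move=> a b; rewrite /quot_scale scalerDl quot_piD. Qed.

HB.instance Definition _ := GRing.Zmodule_isLmodule.Build F quot_sort
  quot_scaleA quot_scale1 quot_scaleDr quot_scaleDl.

Definition quot_act (g : gT) (x : quot_sort) : quot_sort :=
  \pi_quot_sort (lact g (generic_quotient.repr x)).

Lemma quot_act_pi g (v : rho) : g \in H ->
  quot_act g (\pi_quot_sort v) = \pi_quot_sort (lact g v).
Proof.
move=> Hg; apply/quot_eqE.
rewrite -lactB //; apply: subrep_stable => //; apply/quot_eqE; exact: reprK.
Qed.

Lemma quot_linear g : g \in H -> linear (quot_act g).
Proof.
move=> Hg a x y; rewrite -[x in LHS]reprK -[y in LHS]reprK.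
rewrite [a *: _]quot_piZ -quot_piD quot_act_pi // lact_linear // quot_piD.
by congr (_ + _); rewrite -quot_piZ.
Qed.

Lemma quot_act1 x : quot_act 1%g x = x.
Proof. by rewrite /quot_act lact1; exact: reprK. Qed.

Lemma quot_actM :
  {in H &, forall g h x, quot_act (g * h)%g x = quot_act g (quot_act h x)}.
Proof. by move=> g h Hg Hh x; rewrite [RHS]quot_act_pi // /quot_act lactM. Qed.

Definition quot_rep : lrep F H := LRep quot_linear quot_act1 quot_actM.
End Quotient.

End Constructions.

Section GL2.
Variable p : nat.

Notation gl2 := {'GL_2(p)}.

(* The matrix (a b; c d) has entries a = g 0 0, b = g 0 1, c = g 1 0, d = g 1 1. *)
Definition borel : {set gl2} := [set g : gl2 | GLval g 1 0 == 0].

Lemma borelM (g h : gl2) (i : 'I_2) : g \in borel -> h \in borel ->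
  GLval (g * h)%g i i = GLval g i i * GLval h i i.
Proof.
rewrite !inE => /eqP g10 /eqP h10; rewrite GL_MxE mxE !big_ord_recl big_ord0.
rewrite addr0; have -> : lift ord0 ord0 = 1 :> 'I_2 by apply/val_inj.
have [->|->] : i = 0 \/ i = 1.
  by case: i => [[|[|//]] ?]; [left|right]; apply/val_inj.
- by rewrite h10 mulr0 addr0.
- by rewrite g10 mul0r add0r.
Qed.

Lemma borel_group_set : group_set borel.
Proof.
apply/group_setP; split=> [|g h]; first by rewrite inE GL_1E !mxE.
rewrite !inE => /eqP g10 /eqP h10; rewrite GL_MxE mxE !big_ord_recl big_ord0.
have -> : lift ord0 ord0 = 1 :> 'I_2 by apply/val_inj.
by rewrite g10 h10 mul0r mulr0 !addr0.
Qed.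

Canonical borel_group := group borel_group_set.

Lemma diag1 (i : 'I_2) : GLval (1%g : gl2) i i = 1.
Proof. by rewrite GL_1E !mxE eqxx. Qed.

Definition char_a : lchar 'F_p borel :=
  LChar (diag1 0) (fun g h Bg Bh => borelM 0 Bg Bh).

Definition char_d : lchar 'F_p borel :=
  LChar (diag1 1) (fun g h Bg Bh => borelM 1 Bg Bh).

Lemma char_d_exp1 (s : int) : char_d 1%g ^ s = 1.
Proof. by rewrite lchar1 exp1rz. Qed.

Lemma char_d_expM (s : int) : {in borel &, forall g h,
  char_d (g * h)%g ^ s = char_d g ^ s * char_d h ^ s}.
Proof. by move=> g h Bg Bh; rewrite lcharM // expfzMl. Qed.

Definition char_d_exp (s : int) : lchar 'F_p borel :=
  LChar (char_d_exp1 s) (@char_d_expM s).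

Notation poly2 := {mpoly 'F_p[2]}.
Notation X := ('X_0 : poly2).
Notation Y := ('X_1 : poly2).

(* The substitution (X, Y) |-> (aX + cY, bX + dY) *)
Definition subst_GL (g : gl2) : 2.-tuple poly2 :=
  [tuple GLval g 0 0 *: X + GLval g 1 0 *: Y;
         GLval g 0 1 *: X + GLval g 1 1 *: Y].

Lemma subst_GL_XE (g : gl2) (i : 'I_2) :
  'X_i \mPo subst_GL g = GLval g 0 i *: X + GLval g 1 i *: Y.
Proof.
rewrite comp_mpolyXU.
by have [->|->] : i = 0 \/ i = 1;
  first by case: i => [[|[|//]] ?]; [left|right]; apply/val_inj.
Qed.

Lemma tnth_subst_GL (g : gl2) (i : 'I_2) :
  tnth (subst_GL g) i = GLval g 0 i *: X + GLval g 1 i *: Y.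
Proof. by rewrite -subst_GL_XE comp_mpolyXU -tnth_nth. Qed.

Lemma homog_subst_GL (g : gl2) (r : nat) (P : poly2) :
  P \is r.-homog -> P \mPo subst_GL g \is r.-homog.
Proof.
move=> /dhomogP Pr; rewrite comp_mpolyE big_seq rpred_sum // => m /Pr mr.
apply: rpredZ; rewrite big_ord_recl big_ord1 -mr.
have homX (i : 'I_2) k : tnth (subst_GL g) i ^+ k \is k.-homog.
  rewrite -[D in D.-homog]mul1n; apply: dhomogMn.
  by rewrite tnth_subst_GL rpredD // rpredZ // dhomogX /= mdeg1.
have mE : mdeg m = (m ord0 + m (lift ord0 ord0))%N.
  by rewrite mdegE big_ord_recl big_ord1.
by rewrite /= mE; apply: dhomogM.
Qed.

Lemma subst_GL1 (P : poly2) : P \mPo subst_GL 1%g = P.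
Proof.
suff -> : subst_GL (1%g : gl2) = [tuple 'X_i | i < 2] by exact: comp_mpoly_id.
apply: eq_from_tnth => i; rewrite tnth_subst_GL tnth_mktuple GL_1E !mxE.
have [->|->] : i = 0 \/ i = 1.
  by case: i => [[|[|//]] ?]; [left|right]; apply/val_inj.
- by rewrite /= scale1r scale0r addr0.
- by rewrite /= scale1r scale0r add0r.
Qed.

Lemma subst_GLM (g h : gl2) (P : poly2) :
  P \mPo subst_GL (g * h)%g = (P \mPo subst_GL h) \mPo subst_GL g.
Proof.
rewrite [P \mPo subst_GL h]comp_mpolyE [LHS]comp_mpolyE raddf_sum /=.
apply: eq_bigr => m _.
rewrite comp_mpolyZ rmorph_prod /=; congr (_ *: _); apply: eq_bigr => i _.
rewrite rmorphXn /= !tnth_subst_GL raddfD /= !comp_mpolyZ !subst_GL_XE.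
rewrite -!mulmxE !mxE !big_ord_recl !big_ord0.
have -> : lift ord0 ord0 = 1 :> 'I_2 by apply/val_inj.
congr (_ ^+ _); rewrite !addr0 !scalerDr !scalerDl !scalerA.
by rewrite addrACA ![GLval h _ _ * _]mulrC.
Qed.

Section Sym.
Variable r : nat.

Definition sym_act (g : gl2) (P : dhomog 2 'F_p r) : dhomog 2 'F_p r :=
  DHomog (homog_subst_GL g (dhomog_is_dhomog P)).

Lemma sym_linear g : g \in [set: gl2] -> linear (sym_act g).
Proof. by move=> _ a P Q; apply/val_inj; rewrite /= linearP. Qed.

Lemma sym_act1 P : sym_act 1%g P = P.
Proof. by apply/val_inj; rewrite /= subst_GL1. Qed.

Lemma sym_actM : {in [set: gl2] &, forall g h P,
  sym_act (g * h)%g P = sym_act g (sym_act h P)}.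
Proof. by move=> g h _ _ P; apply/val_inj; rewrite /= subst_GLM. Qed.

(* The r-th symmetric power V_r of the standard representation *)
Definition sym_rep : lrep 'F_p [set: gl2] := LRep sym_linear sym_act1 sym_actM.
End Sym.

Definition theta : poly2 := X ^+ p * Y - X * Y ^+ p.

Section Divisible.
Hypothesis p_prime : prime p.
Variables r k : nat.

Definition theta_dvd : {pred sym_rep r} :=
  fun P : dhomog 2 'F_p r =>
    `[< exists Q : poly2, (P : poly2) = theta ^+ k * Q >].

Lemma theta_dvd_closed : submod_closed theta_dvd.
Proof.
split=> [|a P Q /asboolP[P' PE] /asboolP[Q' QE]]; apply/asboolP.
  by exists 0; rewrite mulr0.
by exists (a *: P' + Q'); rewrite /= PE QE mulrDr scalerAr.
Qed.

Lemma theta_subst_GL g : theta \mPo subst_GL g = \det (GLval g) *: theta.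
Proof.
have Fr : p \in [pchar poly2] by rewrite pchar_lalg pchar_Fp.
have FrZ (a : 'F_p) (P : poly2) : (a *: P) ^+ p = a *: P ^+ p.
  rewrite exprZn; congr (_ *: _).
  have pF : p \in [pchar 'F_p] by exact: pchar_Fp.
  by rewrite -[a]natr_Zp -(pFrobenius_autE pF) pFrobenius_aut_nat.
have FrD (P Q : poly2) : (P + Q) ^+ p = P ^+ p + Q ^+ p.
  exact: (rmorphD (pFrobenius_aut Fr)).
rewrite /theta raddfB /= !rmorphM !rmorphXn /= !subst_GL_XE !FrD !FrZ.
have detE : \det (GLval g) = GLval g 0 0 * GLval g 1 1 - GLval g 0 1 * GLval g 1 0.
  rewrite (expand_det_row _ 0) !big_ord_recl big_ord0 /cofactor !det_mx11 !mxE.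
  have -> : lift ord0 ord0 = 1 :> 'I_2 by apply/val_inj.
  have -> : lift 1 0 = 0 :> 'I_2 by apply/val_inj.
  by rewrite !addr0 expr0 expr1 mul1r mulN1r mulrN.
rewrite detE -!mul_mpolyC mpolyCB !mpolyCM; ring.
Qed.

Lemma theta_dvd_stable :
  {in [set: gl2], forall g, {homo lact (l := sym_rep r) g : P / P \in theta_dvd}}.
Proof.
move=> g _ P /asboolP[Q PE]; apply/asboolP.
exists (\det (GLval g) ^+ k *: (Q \mPo subst_GL g)).
by rewrite /= PE rmorphM rmorphXn /= theta_subst_GL exprZn -scalerAl -scalerAr.
Qed.

(* V_r^(k), the multiples of theta ^+ k in V_r *)
Definition sym_theta : subrep (sym_rep r) :=
  SubRep theta_dvd_closed theta_dvd_stable.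
End Divisible.

Definition sym_borel (m : nat) : lrep 'F_p borel := res_rep (subsetT _) (sym_rep m).

(* The semi-simplification of the restriction of V_1 to B, whose constituents
   are the line of X and its quotient, by sym_borel1_X and sym_borel1_Y. *)
Definition sym1_ss : lrep 'F_p borel := dsum_rep (char_rep char_a) (char_rep char_d).

Lemma homogX (i : 'I_2) : ('X_i : poly2) \is 1.-homog.
Proof. by rewrite dhomogX /= mdeg1. Qed.

Lemma sym_borel1_X g : g \in borel ->
  lact (l := sym_borel 1) g (DHomog (homogX 0)) = char_a g *: DHomog (homogX 0).
Proof.
rewrite inE => /eqP g10; apply/val_inj.
by rewrite /= subst_GL_XE g10 scale0r addr0.
Qed.

Lemma sym_borel1_Y g :
  lact (l := sym_borel 1) g (DHomog (homogX 1)) =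
  char_d g *: DHomog (homogX 1) + GLval g 0 1 *: DHomog (homogX 0).
Proof. by apply/val_inj; rewrite /= subst_GL_XE addrC. Qed.

End GL2.

(* Main.v *)
From HB Require Import structures.
Require Import Defs.
From mathcomp Require Import all_boot all_algebra all_fingroup.
From mathcomp Require Import finfield.
From mathcomp Require Import boolp mpoly ring zify.
Import GRing.Theory.
Local Open Scope ring_scope.
Local Open Scope quotient_scope.

Set Implicit Arguments.
Unset Strict Implicit.
Unset Printing Implicit Defensive.

(** The quotient of V_r by the forms divisible by X^(m+1) is a representation of
    B of dimension m + 1, since B preserves the line spanned by X. A B-map phi
    from V_r to sigma whose kernel consists of the multiples of X^(m+1)
    corresponds by Frobenius reciprocity to the GL_2-map P |-> (g |-> phi(g P))
    from V_r to ind sigma.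

    Its kernel consists of the P such that X^(m+1) divides every translate g P,
    that is, such that P vanishes to order m + 1 along each of the p + 1 lines
    defined over F_p. As theta is, up to sign, the product of the equations of
    these lines (theta_lines), the kernel is the space of multiples of
    theta^(m+1) (theta_exp_dvd).

    The map is onto by a Chinese remainder argument. The product N of the
    (m+1)-st powers of the p linear forms Y - uX becomes a unit modulo X^(m+1)
    once Y is inverted, and the multiples of N in V_r have arbitrary residue
    modulo X^(m+1) (homog_approx; this is where r >= (m+1)(p+1) - 1 enters).
    Their images in ind sigma are supported on the coset B, and the translates
    of these functions fill ind sigma (frobenius_surj). Together this gives
    sym_quot_iso_ind.

    It remains to find phi and sigma. The divided-power derivative of order
    r - m in Y maps X^i Y^(r-i) to C(r-i, r-m) X^i Y^(m-i); it is a B-map from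
    V_r to V_m tensored with d^(r-m). Since m < p, all these binomial
    coefficients with i <= m are nonzero in F_p as soon as C(r, m) is, and then
    the kernel is as required. If instead m = 1 and p divides r, the unipotent
    elements of B fix Y^r modulo X^2, so the coefficients of X Y^(r-1) and Y^r
    give a B-map to the sum of the characters a d^(r-1) and d^r. *)

(** * The first isomorphism theorem and Frobenius reciprocity *)

Section FirstIsomorphism.
Context {F : fieldType} {gT : finGroupType} {H : {set gT}} {rho tau : lrep F H}.
Variables (U : subrep rho) (f : {linear rho -> tau}).
Hypothesis fH : {in H, forall g (v : rho), f (lact g v) = lact g (f v)}.
Hypothesis kerf : forall v, (v \in subrep_pred U) = (f v == 0).
Hypothesis surjf : forall w, exists v, f v = w.

(* A class is evaluated at its chosen representative; fbar_pi makes the choice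
   irrelevant. *)
Let fbar (x : quot_rep U) : tau := f (generic_quotient.repr (x : quot_sort U)).

Let fbar_pi (v : rho) : fbar (\pi_(quot_sort U) v) = f v.
Proof.
apply/eqP; rewrite -subr_eq0 -raddfB -kerf.
by apply/quot_eqE; exact: reprK.
Qed.

Let fbar_linear : linear fbar.
Proof.
move=> a x y; rewrite -[x in LHS]reprK -[y in LHS]reprK.
by rewrite [a *: _]quot_piZ -quot_piD fbar_pi linearP.
Qed.

Lemma lrep_iso_quot : lrep_iso (quot_rep U) tau.
Proof.
pose fL := GRing.isLinear.Build F (quot_rep U) tau _ fbar fbar_linear.
pose fbarL : {linear quot_rep U -> tau} := HB.pack fbar fL.
exists fbarL; last first.
  move=> g Hg x; rewrite -[x]reprK [lact g _]quot_act_pi //.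
  by rewrite /= !fbar_pi fH.
exists (fun w => \pi_(quot_sort U) (sval (cid (surjf w)))) => [x|w] /=.
  rewrite -[RHS]reprK; apply/quot_eqE; rewrite kerf raddfB subr_eq0.
  by apply/eqP; case: cid.
by rewrite fbar_pi; case: cid.
Qed.
End FirstIsomorphism.

Section Frobenius.
Context {F : fieldType} {gT : finGroupType} {H : {group gT}}.
Context {rho : lrep F [set: gT]} {sigma : lrep F H}.
Variable phi : {linear rho -> sigma}.
Hypothesis phiH : {in H, forall h (v : rho), phi (lact h v) = lact h (phi v)}.

Lemma frobenius_subproof (v : rho) :
  [ffun g => phi (lact g v)] \in ind_pred (sigma := sigma).
Proof.
by apply/ind_predP => h Hh g; rewrite !ffunE lactM ?in_setT // phiH.
Qed.

(** The map rho -> ind sigma that corresponds to the H-map phi : rho -> sigma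
    under Frobenius reciprocity. *)
Definition frobenius (v : rho) : ind_rep sigma := Induced (frobenius_subproof v).

Lemma frobenius_linear : linear frobenius.
Proof.
move=> a u v; apply/val_inj/ffunP => g /=; rewrite !ffunE.
by rewrite lact_linear ?in_setT // linearP.
Qed.

HB.instance Definition _ :=
  GRing.isLinear.Build F rho (ind_rep sigma) _ frobenius frobenius_linear.

Lemma frobenius_act : {in [set: gT], forall g v,
  frobenius (lact g v) = lact g (frobenius v)}.
Proof.
move=> g _ v; apply/val_inj/ffunP => x /=; rewrite !ffunE.
by rewrite lactM ?in_setT.
Qed.

Lemma frobenius_eq0 v :
  (frobenius v == 0) = [forall g, phi (lact g v) == 0].
Proof.
apply/eqP/forallP => [/(congr1 (@ind_fun _ _ _ _)) v0 g|v0].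
  by move/ffunP/(_ g): v0; rewrite /= !ffunE => ->.
by apply/val_inj/ffunP => g /=; rewrite !ffunE; apply/eqP.
Qed.

(** If phi kills the translates of v by the elements outside H, then the image
    of v in the induced representation is supported on the coset H, where it is
    determined by phi v. When phi v can be prescribed for such v, translating
    them by coset representatives prescribes a function coset by coset. *)
Lemma frobenius_surj :
  (forall w, exists v, phi v = w /\
     forall g, g \notin H -> phi (lact g v) = 0) ->
  forall f, exists v, frobenius v = f.
Proof.
move=> /choice[s sP] f.
exists (\sum_(C in rcosets H [set: gT])
          lact (repr C)^-1%g (s (f (repr C)))).
apply/val_inj/ffunP => g /=; rewrite ffunE.
have act_sum : lact g (\sum_(C in rcosets H [set: gT])
    lact (repr C)^-1%g (s (f (repr C)))) = \sum_(C in rcosets H [set: gT])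
    lact (l := rho) (g * (repr C)^-1)%g (s (f (repr C))).
  elim/big_rec2: _ => [|C u v _ IH]; first by rewrite lact0 ?in_setT.
  by rewrite lactD ?in_setT // IH lactM ?in_setT.
rewrite act_sum raddf_sum (bigD1 (H :* g)%g) /=; last first.
  by apply/rcosetsP; exists g; rewrite ?in_setT.
rewrite big1 => [|C /andP[/rcosetsP[x _ ->]] neC]; last first.
  rewrite (proj2 (sP _)) //; apply: contra neC => gx.
  rewrite -mem_rcoset rcoset_repr in gx.
  by apply/eqP/esym/rcoset_eqP.
have Hg : (g * (repr (H :* g)%g)^-1)%g \in H.
  by rewrite -mem_rcoset rcoset_repr rcoset_refl.
by rewrite addr0 phiH // (proj1 (sP _)) -(ind_predP _ (ind_funP f)) // mulgKV.
Qed.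
End Frobenius.

(** * Binary forms and their restriction to a line *)

Section BinaryForms.
Variable F : fieldType.
Local Notation poly2 := {mpoly F[2]}.
Local Notation X := ('X_0 : poly2).
Local Notation Y := ('X_1 : poly2).

Definition mon (i j : nat) : 'X_{1..2} :=
  [multinom if l == 0 :> nat then i else j | l < 2].

Lemma monP (mo : 'X_{1..2}) : mo = mon (mo 0) (mo 1).
Proof.
apply/mnmP => l; rewrite mnmE.
by case: l => [[|[|//]] ?] /=; congr (mo _); apply/val_inj.
Qed.

Lemma mdeg_mon i j : mdeg (mon i j) = (i + j)%N.
Proof. by rewrite mdegE !big_ord_recl big_ord0 addn0 !mnmE. Qed.

Lemma mpolyX_mon i j : 'X_[mon i j] = X ^+ i * Y ^+ j :> poly2.
Proof.
rewrite mpolyXE_id !big_ord_recl big_ord0 mulr1 !mnmE /=.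
by congr ('X_ _ ^+ _ * 'X_ _ ^+ _); apply/val_inj.
Qed.

Lemma monD i j i' j' : (mon i j + mon i' j')%MM = mon (i + i') (j + j').
Proof. by apply/mnmP => l; rewrite mnmDE !mnmE; case: ifP. Qed.

Lemma mon_eq i j i' j' : (mon i j == mon i' j') = (i == i') && (j == j').
Proof.
apply/eqP/andP => [/mnmP E|[/eqP-> /eqP->] //].
by move: (E 0) (E 1); rewrite !mnmE /= => -> ->.
Qed.

Lemma X_neq0 : X != 0.
Proof.
apply/eqP => /mpolyP/(_ U_(0%R)%MM)/eqP.
by rewrite mcoeffXU mcoeff0 oner_eq0.
Qed.

Lemma Y_neq0 : Y != 0.
Proof.
apply/eqP => /mpolyP/(_ U_(1%R)%MM)/eqP.
by rewrite mcoeffXU mcoeff0 oner_eq0.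
Qed.

Lemma comp_mpolyM (t : 2.-tuple poly2) (P Q : poly2) :
  (P * Q) \mPo t = (P \mPo t) * (Q \mPo t).
Proof. exact: rmorphM. Qed.

Lemma Xn_dvdP k (P : poly2) :
  (exists Q, P = X ^+ k * Q) <-> (forall i j, (i < k)%N -> P@_(mon i j) = 0).
Proof.
split=> [[Q ->] i j ik|P0].
  rewrite [Q]mpolyE mulr_sumr raddf_sum big1 // => mo _.
  rewrite [mo]monP mpolyX_mon -scalerAr mulrA -exprD -mpolyX_mon.
  rewrite /= mcoeffZ mcoeffX mon_eq; case: eqP => [E|_]; last by rewrite mulr0.
  by rewrite -E ltnNge leq_addr in ik.
exists (\sum_(mo <- msupp P) P@_mo *: (X ^+ (mo 0 - k) * Y ^+ mo 1)).
rewrite [LHS]mpolyE mulr_sumr; apply: eq_bigr => mo _.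
rewrite {1 2}[mo]monP; case: (ltnP (mo 0) k) => k_mo.
  by rewrite P0 // [in RHS](monP mo) P0 // !scale0r mulr0.
rewrite -monP -scalerAr mulrA -exprD subnKC //.
by rewrite -mpolyX_mon -monP.
Qed.

(** The restriction of a form to the line X = 0. Working with it instead of with
    divisibility by X makes it plain that X is prime: it is a ring morphism to a
    domain. *)
Definition at_X0 : poly2 -> poly2 := comp_mpoly [tuple 0; Y].

HB.instance Definition _ :=
  GRing.RMorphism.copy at_X0 (comp_mpoly [tuple 0; Y]).
HB.instance Definition _ :=
  GRing.Linear.copy at_X0 (comp_mpoly [tuple 0; Y]).

Lemma at_X0_X : at_X0 X = 0.
Proof. by rewrite /at_X0 comp_mpolyXU. Qed.

Lemma at_X0_Y : at_X0 Y = Y.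
Proof. by rewrite /at_X0 comp_mpolyXU. Qed.

Lemma at_X0M P Q : at_X0 (P * Q) = at_X0 P * at_X0 Q.
Proof. exact: rmorphM. Qed.

Lemma at_X0E P : exists Q, P = at_X0 P + X * Q.
Proof.
rewrite [P]mpolyE raddf_sum /=.
elim/big_ind2: _ => [|? A ? B [QA ->] [QB ->]|mo _].
- by exists 0; rewrite mulr0 addr0.
- by exists (QA + QB); rewrite mulrDr addrACA.
move: P@_mo => c; rewrite linearZ /= [mo]monP mpolyX_mon rmorphM !rmorphXn /=.
rewrite at_X0_X at_X0_Y.
case: (mo 0) => [|i]; first by exists 0; rewrite mulr0 addr0.
exists (c *: (X ^+ i * Y ^+ mo 1)).
by rewrite expr0n mul0r scaler0 add0r exprS -scalerAr mulrA.
Qed.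

Lemma X_dvdP P : at_X0 P = 0 <-> exists Q, P = X * Q.
Proof.
split=> [P0|[Q ->]]; last by rewrite rmorphM /= at_X0_X mul0r.
by have [Q] := at_X0E P; rewrite P0 add0r; exists Q.
Qed.

Lemma homog_XY i j : X ^+ i * Y ^+ j \is (i + j).-homog.
Proof. by rewrite -mpolyX_mon dhomogX /= mdeg_mon. Qed.

(** Meant for i <= r: for larger i the truncated r - i selects a coefficient of
    another degree. *)
Definition hcoef (r i : nat) (P : poly2) : F := P@_(mon i (r - i)).

Lemma homog_mcoeff r (P : poly2) i j :
  P \is r.-homog -> P@_(mon i j) = hcoef r i P *+ (i + j == r)%N.
Proof.
move=> Pr; case: eqP => [<-|/eqP ne]; first by rewrite /hcoef addKn.
by rewrite (dhomog_nemf_coeff Pr) //= mdeg_mon.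
Qed.

Definition binary_form r (c : nat -> F) : poly2 :=
  \sum_(i < r.+1) c i *: (X ^+ i * Y ^+ (r - i)).

Lemma binary_form_homog m c : binary_form m c \is m.-homog.
Proof.
apply: rpred_sum => i _; apply: rpredZ.
by have := homog_XY i (m - i); rewrite subnKC // -ltnS.
Qed.

Lemma hcoef_binary_form m c i : (i <= m)%N -> hcoef m i (binary_form m c) = c i.
Proof.
rewrite -ltnS => im; rewrite /hcoef raddf_sum (bigD1 (Ordinal im)) //= big1 => [|j].
  by rewrite addr0 mcoeffZ -mpolyX_mon mcoeffX eqxx mulr1.
rewrite -val_eqE /= => /negPf ne.
by rewrite mcoeffZ -mpolyX_mon mcoeffX mon_eq ne mulr0.
Qed.

Lemma binary_formE r (P : poly2) : P \is r.-homog ->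
  P = binary_form r (fun i => hcoef r i P).
Proof.
move=> Pr; apply/mpolyP => mo; rewrite [mo]monP; move: (mo 0) (mo 1) => i j.
rewrite /binary_form raddf_sum (eq_bigr (fun l : 'I_r.+1 =>
  hcoef r l P *+ ((l == i :> nat) && (i + j == r))%N)); last first.
  move=> l _ /=; rewrite mcoeffZ -mpolyX_mon mcoeffX mon_eq mulr_natr.
  congr (_ *+ _); congr nat_of_bool; apply: andb_id2l => /eqP <-.
  by rewrite -(eqn_add2l l) subnKC -1?ltnS // eq_sym.
rewrite (homog_mcoeff i j Pr); case: eqP => [ijr|_]; last first.
  by rewrite big1 // => l _; rewrite andbF.
have ir : (i < r.+1)%N by rewrite ltnS -ijr leq_addr.
rewrite (bigD1 (Ordinal ir)) //= eqxx big1 ?addr0 // => l; rewrite -val_eqE /=.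
by move/negPf ->.
Qed.

Lemma hcoef_inj m (P Q : poly2) : P \is m.-homog -> Q \is m.-homog ->
  (forall i, (i <= m)%N -> hcoef m i P = hcoef m i Q) -> P = Q.
Proof.
move=> Ph Qh PQ; rewrite (binary_formE Ph) [RHS](binary_formE Qh).
by apply: eq_bigr => i _; rewrite PQ // -ltnS.
Qed.

Lemma hcoefZ m i a (P : poly2) : hcoef m i (a *: P) = a * hcoef m i P.
Proof. exact: mcoeffZ. Qed.

Lemma hcoefD m i (P Q : poly2) : hcoef m i (P + Q) = hcoef m i P + hcoef m i Q.
Proof. exact: mcoeffD. Qed.

Lemma at_X0_mcoeff P j : (at_X0 P)@_(mon 0 j) = P@_(mon 0 j).
Proof.
have [Q E] := at_X0E P; rewrite [in RHS]E mcoeffD.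
by rewrite (proj1 (Xn_dvdP 1 (X * Q))) ?addr0 //; exists Q.
Qed.

(** As N restricts to a power of Y on the line X = 0, it becomes invertible in
    the power series in X once Y is inverted, and P / N can be computed one
    coefficient at a time. The degree bound keeps the exponents of Y in the
    first k coefficients nonnegative. *)
Lemma homog_approx n r k (N P : poly2) :
    N \is n.-homog -> at_X0 N = Y ^+ n -> P \is r.-homog -> (n + k <= r.+1)%N ->
  exists2 Q, Q \is (r - n).-homog &
    forall i, (i < k)%N -> hcoef r i (N * Q) = hcoef r i P.
Proof.
move=> Nn N0 Pr; elim: k => [|k IH] le_r.
  by exists 0; rewrite ?dhomog0.
have [|Q Qh QP] := IH; first by rewrite addnS in le_r; apply: ltnW.
have kr : (n + k <= r)%N by rewrite addnS ltnS in le_r.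
(* A multiple of X^k leaves the coefficients below k alone, and N contributes
   Y^n to the coefficient of X^k, so this c is the right correction. *)
pose c := hcoef r k P - hcoef r k (N * Q).
have krn : (k <= r - n)%N by rewrite leq_subRL // (leq_trans _ kr) // leq_addr.
exists (Q + c *: (X ^+ k * Y ^+ (r - n - k))).
  have := homog_XY k (r - n - k); rewrite subnKC // => h.
  by rewrite rpredD ?rpredZ.
move=> i; rewrite ltnS leq_eqVlt mulrDr -scalerAr /hcoef mcoeffD mcoeffZ.
case/orP => [/eqP->|ik]; last first.
  have -> : (N * (X ^+ k * Y ^+ (r - n - k)))@_(mon i (r - i)) = 0.
    apply: (proj1 (Xn_dvdP k _)) => //.
    by exists (N * Y ^+ (r - n - k)); rewrite mulrCA.
  by rewrite mulr0 addr0 -[LHS]/(hcoef r i _) QP.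
have E : mon k (r - k) = (mon k (r - n - k) + mon 0 n)%MM.
  rewrite monD addn0 subnAC subnK // leq_subRL 1?addnC //.
  by rewrite (leq_trans _ kr) // leq_addl.
rewrite -mpolyX_mon {2}E [(N * 'X_[_])@__]mcoeffMX -at_X0_mcoeff N0.
rewrite -[Y ^+ n]mul1r -(expr0 X) -mpolyX_mon mcoeffX eqxx mulr1.
by rewrite /c /hcoef addrC subrK.
Qed.
End BinaryForms.

(** * The action of GL_2 and of its Borel subgroup on coefficients *)

Section GL2Forms.
Variable p : nat.
Local Notation gl2 := {'GL_2(p)}.
Local Notation poly2 := {mpoly 'F_p[2]}.
Local Notation X := ('X_0 : poly2).
Local Notation Y := ('X_1 : poly2).
Implicit Types (g : gl2) (P : poly2).

(** For upper triangular g the substitution is X -> aX, Y -> bX + dY, and the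
    binomial expansion of (aX)^i (bX + dY)^(r-i) only involves powers of X of
    exponent at least i. Hence B acts on the first coefficients alone. *)
Lemma hcoef_borel r k g P : g \in borel p -> P \is r.-homog -> (k <= r)%N ->
  hcoef r k (P \mPo subst_GL g) =
  \sum_(i < k.+1) hcoef r i P *
     ('C(r - i, k - i)%:R * GLval g 0 0 ^+ i * GLval g 0 1 ^+ (k - i)
        * GLval g 1 1 ^+ (r - k)).
Proof.
rewrite inE => /eqP g10 Pr kr.
pose t i : 'F_p := 'C(r - i, k - i)%:R * GLval g 0 0 ^+ i
  * GLval g 0 1 ^+ (k - i) * GLval g 1 1 ^+ (r - k).
have tP (i : 'I_r.+1) :
    hcoef r k ((X ^+ i * Y ^+ (r - i)) \mPo subst_GL g) = t i *+ (i <= k)%N.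
  rewrite rmorphM !rmorphXn /= !subst_GL_XE g10 scale0r addr0 addrC exprDn.
  rewrite mulr_sumr /hcoef raddf_sum /=.
  have coefE (j : 'I_(r - i).+1) : (((GLval g 0 0 *: X) ^+ i *
     ((GLval g 1 1 *: Y) ^+ (r - i - j) * (GLval g 0 1 *: X) ^+ j
        *+ 'C(r - i, j)))@_(mon k (r - k))) =
     'C(r - i, j)%:R * GLval g 0 0 ^+ i * GLval g 0 1 ^+ j
       * GLval g 1 1 ^+ (r - i - j) *+ (i + j == k)%N.
    transitivity (('C(r - i, j)%:R * GLval g 0 0 ^+ i * GLval g 0 1 ^+ j
       * GLval g 1 1 ^+ (r - i - j)
         *: 'X_[mon (i + j) (r - i - j)])@_(mon k (r - k))).
      congr (mcoeff _ _); rewrite !exprZn mpolyX_mon exprD -!mul_mpolyC -mulr_natr.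
      by rewrite !mpolyCM mpolyC_nat; ring.
    rewrite mcoeffZ mcoeffX mon_eq mulr_natr; congr (_ *+ nat_of_bool _).
    by case: eqP => //= <-; rewrite -subnDA eqxx.
  rewrite (eq_bigr _ (fun j _ => coefE j)).
  case: leqP => [ik|ki]; last first.
    by rewrite big1 // => j _; rewrite gtn_eqF ?mulr0n // (leq_trans ki) ?leq_addr.
  have kir : (k - i < (r - i).+1)%N by rewrite ltnS leq_sub2r.
  rewrite (bigD1 (Ordinal kir)) //= subnKC // eqxx mulr1n big1 ?addr0.
    by rewrite /t (_ : (r - i - (k - i) = r - k)%N) //; lia.
  move=> j; rewrite -val_eqE /= => /negPf ne.
  by rewrite -[k in X in _ *+ nat_of_bool X](subnKC ik) eqn_add2l ne.
rewrite [LHS]/hcoef [in LHS](binary_formE Pr) /binary_form.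
rewrite (raddf_sum (comp_mpoly (subst_GL g))) /= raddf_sum.
rewrite (big_ord_widen r.+1 (fun i => hcoef r i P * t i)) ?ltnS //.
rewrite [RHS]big_mkcond; apply: eq_bigr => i _.
by rewrite /= linearZ /= mcoeffZ -[(_)@__]/(hcoef r k _) tP ltnS mulrnAr; case: ifP.
Qed.

Lemma GL_of_mx (A : 'M['F_p]_2) : A \in unitmx -> exists g : gl2, GLval g = A.
Proof. by move=> Au; exists (FinRing.Unit Au). Qed.

Lemma det_mx2 (R : comNzRingType) (A : 'M[R]_2) :
  \det A = A 0 0 * A 1 1 - A 0 1 * A 1 0.
Proof.
rewrite (expand_det_row _ 0) !big_ord_recl big_ord0 /cofactor !det_mx11 !mxE.
have -> : lift ord0 ord0 = 1 :> 'I_2 by apply/val_inj.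
have -> : lift 1 0 = 0 :> 'I_2 by apply/val_inj.
by rewrite !addr0 expr0 expr1 mul1r mulN1r mulrN.
Qed.

(** Such a g sends the linear form Y - uX to X. *)
Lemma GL_line_to_X (u : 'F_p) :
  exists g, X \mPo subst_GL g = Y /\ Y \mPo subst_GL g = X + u *: Y.
Proof.
pose A : 'M['F_p]_2 := \matrix_(i, j)
  if i == 0 then (j == 1)%:R else if j == 0 then 1 else u.
have [|g gA] := @GL_of_mx A.
  by rewrite unitmxE det_mx2 !mxE /= mul0r mul1r sub0r unitrN unitr1.
exists g; rewrite !subst_GL_XE gA !mxE /= scale0r !scale1r add0r.
by split.
Qed.

End GL2Forms.

(** * Theta as the product of the lines defined over F_p *)

Section Theta.
Variable p : nat.
Hypothesis p_prime : prime p.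
Local Notation gl2 := {'GL_2(p)}.
Local Notation poly2 := {mpoly 'F_p[2]}.
Local Notation X := ('X_0 : poly2).
Local Notation Y := ('X_1 : poly2).
Implicit Types (g : gl2) (P Q : poly2).

Lemma at_X0_subst_X g : at_X0 (X \mPo subst_GL g) = GLval g 1 0 *: Y.
Proof. by rewrite subst_GL_XE linearD !linearZ /= at_X0_X at_X0_Y scaler0 add0r. Qed.

(** The factors are the equations of the lines of the plane over F_p other than
    X = 0. *)
Definition lines : poly2 := \prod_(u : 'F_p) (Y - u *: X).

(** Homogenising the factorisation of T^p - T over F_p: set T = Y / X in the
    field of fractions and clear denominators. *)
Lemma theta_lines : theta p = X * - lines.
Proof.
have := @finField_genPoly 'F_p; rewrite card_Fp //.
pose f := @FracField.tofrac poly2.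
pose h : {rmorphism 'F_p -> {fraction poly2}} := f \o @mpolyC 2 'F_p.
move=> /(congr1 (map_poly h)) /(congr1 (fun q => q.[f Y / f X])).
rewrite rmorphB rmorph_prod /= map_polyXn map_polyX !hornerE horner_prod.
have fX0 : f X != 0 by rewrite tofrac_eq0 X_neq0.
rewrite (eq_bigr (fun u => f (Y - u *: X) / f X)) => [|u _]; last first.
  rewrite rmorphB /= map_polyX map_polyC !hornerE -mul_mpolyC.
  by rewrite /f tofracB tofracM mulrBl mulfK.
rewrite prodf_div prodr_const card_Fp // -(rmorph_prod f) -/lines => E.
apply/eqP; rewrite -tofrac_eq /theta mulrN tofracB tofracN !tofracM !tofracXn -/f.
have fXp0 : f X ^+ p != 0 by rewrite expf_neq0.
rewrite -[f lines](divfK fXp0) -E expr_div_n.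
by rewrite [(_ - _) * _]mulrBl divfK // mulrBr [f X * (_ / _ * _)]mulrA
  [f X * (_ / _)]mulrC divfK // opprB [f Y * _]mulrC.
Qed.

Lemma linesE : lines = Y ^+ p - X ^+ p.-1 * Y.
Proof.
apply/oppr_inj/(mulfI (X_neq0 _)); rewrite -theta_lines opprB mulrBr mulrA -exprS.
by rewrite prednK // prime_gt0.
Qed.

Lemma lines_homog : lines \is p.-homog.
Proof.
have := prime_gt0 p_prime => p0; rewrite linesE rpredB //.
  by rewrite -[Y ^+ p]mul1r -(expr0 X); exact: homog_XY.
by have := homog_XY 'F_p p.-1 1; rewrite addn1 prednK // expr1.
Qed.

Lemma at_X0_lines : at_X0 lines = Y ^+ p.
Proof.
transitivity (\prod_(u : 'F_p) Y); last by rewrite prodr_const card_Fp.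
rewrite rmorph_prod; apply: eq_bigr => u _.
by rewrite /= linearB linearZ /= at_X0_X at_X0_Y scaler0 subr0.
Qed.

Lemma at_X0_lines_neq0 : at_X0 (- lines) != 0.
Proof. by rewrite rmorphN /= oppr_eq0 at_X0_lines expf_neq0 // Y_neq0. Qed.

(** A form that vanishes on the line Y = uX is divisible by Y - uX, and what is
    left still vanishes on the other lines: carry Y = uX to X = 0 by an element
    of GL_2 and use that restriction to X = 0 is multiplicative. *)
Lemma lines_dvd (s : seq 'F_p) Q :
    uniq s -> (forall g, at_X0 (Q \mPo subst_GL g) = 0) ->
  exists R, Q = \prod_(u <- s) (Y - u *: X) * R.
Proof.
move=> + Q0; elim: s => [_|u s IH /= /andP[us /IH[R QR]]].
  by exists Q; rewrite big_nil mul1r.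
have [g [gX gY]] := GL_line_to_X u.
have /X_dvdP[S RS] : at_X0 (R \mPo subst_GL g) = 0.
  have /eqP := Q0 g; rewrite QR !rmorphM /= !rmorph_prod mulf_eq0 => /orP[|/eqP//].
  rewrite prodf_seq_eq0 => /hasP[v vs /=].
  rewrite comp_mpolyB comp_mpolyZ gX gY linearB linearD !linearZ /= at_X0_X at_X0_Y.
  rewrite add0r scalerN -scalerBl scaler_eq0 (negPf (Y_neq0 _)) orbF subr_eq0 => /eqP uv.
  by rewrite uv vs in us.
exists (S \mPo subst_GL g^-1%g); rewrite big_cons QR [_ * \prod_(_ <- _) _]mulrC -mulrA.
congr (_ * _).
rewrite -[LHS]subst_GL1 -(mulVg g) subst_GLM RS rmorphM /=; congr (_ * _).
have {1}-> : X = (Y - u *: X) \mPo subst_GL g by rewrite comp_mpolyB comp_mpolyZ gX gY addrK.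
by rewrite -subst_GLM mulVg subst_GL1.
Qed.

Lemma theta_dvd1 Q : (forall g, at_X0 (Q \mPo subst_GL g) = 0) ->
  exists R, Q = theta p * R.
Proof.
move=> Q0; have [R QR] := lines_dvd (index_enum_uniq _) Q0.
have /X_dvdP[S RS] : at_X0 R = 0.
  have /eqP := Q0 1%g; rewrite subst_GL1 QR rmorphM /= mulf_eq0 => /orP[|/eqP//].
  by rewrite -oppr_eq0 -rmorphN (negPf at_X0_lines_neq0).
by exists (- S); rewrite theta_lines QR RS -/lines; ring.
Qed.

Lemma det_GL_neq0 g : \det (GLval g) != 0.
Proof. by rewrite -unitfE -unitmxE; exact: valP g. Qed.

(** Divisibility by theta^k can be tested on the line X = 0 alone, provided all
    translates are tested, because GL_2 permutes the lines transitively. The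
    induction removes one factor theta at a time: theta is GL_2-invariant up to
    a scalar and contains X exactly once. *)
Lemma theta_exp_dvd k P :
    (forall g, exists Q, P \mPo subst_GL g = X ^+ k * Q) ->
  exists Q, P = theta p ^+ k * Q.
Proof.
elim: k => [|k IH] XP; first by exists P; rewrite mul1r.
have [|Q PQ] := IH.
  by move=> g; have [Q ->] := XP g; exists (X * Q); rewrite exprSr mulrA.
suff [R QR] : exists R, Q = theta p * R by exists R; rewrite PQ QR mulrA -exprSr.
apply: theta_dvd1 => g; have [S] := XP g.
rewrite PQ rmorphM rmorphXn /= theta_subst_GL // exprZn -scalerAl {1}theta_lines.
rewrite exprMn exprSr -!mulrA scalerAr.
move=> /(mulfI (expf_neq0 _ (X_neq0 _))) /(congr1 (@at_X0 _)).
rewrite linearZ /= !rmorphM rmorphXn /= at_X0_X mul0r => /eqP.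
rewrite scaler_eq0 (negPf (expf_neq0 _ (det_GL_neq0 g))) mulf_eq0.
by rewrite (negPf (expf_neq0 _ at_X0_lines_neq0)) => /eqP.
Qed.

End Theta.

(** * Quotients of symmetric powers as induced representations *)

Section InducedFromBorel.
Variable p : nat.
Hypothesis p_prime : prime p.
Local Notation gl2 := {'GL_2(p)}.
Local Notation poly2 := {mpoly 'F_p[2]}.
Local Notation X := ('X_0 : poly2).
Local Notation Y := ('X_1 : poly2).
Local Notation lines := (lines p).
Implicit Types (g : gl2) (P Q : poly2).

(** An element outside B carries the line X = 0 to another one, on which theta
    vanishes but X does not. *)
Lemma at_X0_subst_cofactor g L :
  g \notin borel p -> theta p = X * L -> at_X0 (L \mPo subst_GL g) = 0.
Proof.
rewrite inE => g10 thetaE.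
have theta0 : at_X0 (theta p \mPo subst_GL g) = 0.
  by rewrite (theta_subst_GL p_prime) linearZ /= thetaE at_X0M at_X0_X mul0r scaler0.
have/eqP : GLval g 1 0 *: Y * at_X0 (L \mPo subst_GL g) = 0.
  by rewrite -(at_X0_subst_X g) -at_X0M -comp_mpolyM -thetaE.
by rewrite mulf_eq0 scaler_eq0 (negPf g10) (negPf (Y_neq0 _)) => /eqP.
Qed.

Lemma at_X0_subst_lines g : g \notin borel p -> at_X0 (lines \mPo subst_GL g) = 0.
Proof.
move=> gB; apply/oppr_inj; rewrite oppr0.
have <- := at_X0_subst_cofactor gB (theta_lines p_prime).
by rewrite comp_mpolyN [RHS](rmorphN (@at_X0 _)).
Qed.

Lemma theta_exp_subst k Q g :
  exists R, (theta p ^+ k * Q) \mPo subst_GL g = X ^+ k * R.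
Proof.
rewrite rmorphM rmorphXn /= (theta_subst_GL p_prime) (theta_lines p_prime).
exists ((\det (GLval g) *: - lines) ^+ k * (Q \mPo subst_GL g)).
by rewrite mulrA -exprMn scalerAr.
Qed.

Variables (k r : nat) (sigma : lrep 'F_p (borel p)).
Variable phi : {linear sym_rep p r -> sigma}.
Hypothesis phiB : {in borel p, forall h (P : sym_rep p r),
  phi (lact h P) = lact h (phi P)}.
Hypothesis ker_phi : forall P : sym_rep p r,
  phi P = 0 <-> forall i, (i < k)%N -> hcoef r i (mpoly_of_dhomog P) = 0.
Hypothesis phi_surj : forall w, exists P : sym_rep p r, phi P = w.
Hypothesis r_ge : (k * (p + 1) <= r + 1)%N.

Let ker_phi_X (P : sym_rep p r) :
  phi P = 0 <-> exists Q, mpoly_of_dhomog P = X ^+ k * Q.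
Proof.
rewrite ker_phi Xn_dvdP; split=> P0 i => [j|] ik; last exact: P0.
by rewrite (homog_mcoeff i j (dhomog_is_dhomog P)) P0 // mul0rn.
Qed.

(** The Frobenius map of phi has kernel the multiples of theta^k, by
    theta_exp_dvd. For surjectivity, a form with prescribed first k coefficients
    can be chosen divisible by lines^k, which vanishes to order k along every
    line other than X = 0; so phi kills its translates by elements outside B. *)
Lemma sym_quot_iso_ind :
  lrep_iso (quot_rep (sym_theta p_prime r k)) (ind_rep sigma).
Proof.
apply: (@lrep_iso_quot _ _ _ _ _ _ (frobenius phiB)) => [g _ P|P|].
- by rewrite -frobenius_act ?in_setT.
- rewrite frobenius_eq0; apply/asboolP/forallP => [[Q PQ] g|P0].
    by apply/eqP/ker_phi_X; rewrite /= PQ; apply: theta_exp_subst.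
  apply: (theta_exp_dvd p_prime) => g.
  by apply: (proj1 (ker_phi_X (lact (l := sym_rep p r) g P))); apply/eqP/(P0 g).
apply: frobenius_surj => w; have [P <-] := phi_surj w.
have Nh : lines ^+ k \is (p * k).-homog by rewrite dhomogMn ?(lines_homog p_prime).
have N0 : at_X0 (lines ^+ k) = Y ^+ (p * k) by rewrite rmorphXn /= (at_X0_lines p_prime) exprM.
have le_pk : (p * k + k <= r.+1)%N by lia.
have [Q Qh QP] := homog_approx Nh N0 (dhomog_is_dhomog P) le_pk.
have NQh : lines ^+ k * Q \is r.-homog.
  have := dhomogM Nh Qh; rewrite subnKC //; move: r_ge; nia.
exists (DHomog NQh); split=> [|g gB].
  apply/eqP; rewrite -subr_eq0 -raddfB; apply/eqP/ker_phi => i ik.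
  by rewrite /= /hcoef mcoeffB; apply/eqP; rewrite subr_eq0; apply/eqP/QP.
apply/ker_phi_X; rewrite /= rmorphM rmorphXn /=.
have /X_dvdP[R ->] := at_X0_subst_lines gB.
by exists (R ^+ k * (Q \mPo subst_GL g)); rewrite mulrA exprMn.
Qed.
End InducedFromBorel.

(** * The two B-quotients of V_r *)

(** Both sides count the ways to split n elements into parts of sizes s, k and
    n - s - k. *)
Lemma bin_trinomial n s k : (s + k <= n)%N ->
  ('C(n - k, s) * 'C(n, k) = 'C(n - s, k) * 'C(n, s))%N.
Proof.
move=> skn; have [kn sn] : (k <= n)%N /\ (s <= n)%N by lia.
apply/eqP; rewrite -(eqn_pmul2r (fact_gt0 s)) -(eqn_pmul2r (fact_gt0 k)).
rewrite -(eqn_pmul2r (fact_gt0 (n - s - k))); apply/eqP.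
have E1 := bin_fact kn; have E2 := bin_fact sn.
have E3 : ('C(n - k, s) * (s`! * (n - k - s)`!) = (n - k)`!)%N by apply: bin_fact; lia.
have E4 : ('C(n - s, k) * (k`! * (n - s - k)`!) = (n - s)`!)%N by apply: bin_fact; lia.
have e : (n - k - s = n - s - k)%N by lia.
rewrite e in E3.
transitivity n`!; [rewrite -E1 -E3 | rewrite -E2 -E4]; ring.
Qed.

(** Descent on i by (m - i) C(r - i, m - i) = (r - i) C(r - i - 1, m - i - 1),
    where m - i is prime to p because 0 < m - i < p. *)
Lemma prime_ndvd_bin_sub p r m i : prime p -> (m < p)%N -> (i <= m)%N ->
  ~~ (p %| 'C(r, m))%N -> ~~ (p %| 'C(r - i, m - i))%N.
Proof.
move=> p_prime mp; elim: i => [|i IH] im Crm; first by rewrite !subn0.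
have := IH (ltnW im) Crm; apply: contra => pC.
have e : (m - i.+1).+1 = (m - i)%N by rewrite subnSK.
have : (p %| (m - i) * 'C(r - i, m - i))%N.
  by rewrite -e -mul_bin_diag -subnS dvdn_mull.
rewrite Euclid_dvdM // gtnNdvd //; first by rewrite subn_gt0.
exact: leq_ltn_trans (leq_subr _ _) mp.
Qed.

Section Cases.
Variable p : nat.
Hypothesis p_prime : prime p.

Lemma natr_Fp_eq0 n : ((n%:R : 'F_p) == 0) = (p %| n)%N.
Proof. by rewrite (dvdn_pcharf (pchar_Fp p_prime)). Qed.

Lemma char_d_expE m r g : (m <= r)%N ->
  char_d_exp p (r%:Z - m%:Z) g = GLval g 1 1 ^+ (r - m).
Proof. by move=> mr; rewrite /= subzn. Qed.

Lemma sym_rep_eq m (u v : sym_rep p m) :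
  (forall i, (i <= m)%N -> hcoef m i (mpoly_of_dhomog u) = hcoef m i (mpoly_of_dhomog v)) ->
  u = v.
Proof.
by move=> uv; apply/val_inj/(hcoef_inj (dhomog_is_dhomog u) (dhomog_is_dhomog v)).
Qed.

Section Polarization.
Variables m r : nat.
Hypothesis mr : (m <= r)%N.

Local Notation sigma := (twist_rep (sym_borel p m) (char_d_exp p (r%:Z - m%:Z))).

(** This is the divided-power derivative of order r - m with respect to Y. It is
    equivariant under B because the translation Y -> Y + T that defines it
    commutes with the substitutions X -> aX, Y -> bX + dY up to rescaling T by
    d; hence the twist by d^(r-m). *)
Definition polarize (P : sym_rep p r) : sigma :=
  DHomog (binary_form_homog m
    (fun i => 'C(r - i, r - m)%:R * hcoef r i (mpoly_of_dhomog P))).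

Lemma hcoef_polarize P i : (i <= m)%N ->
  hcoef m i (mpoly_of_dhomog (polarize P)) =
    'C(r - i, r - m)%:R * hcoef r i (mpoly_of_dhomog P).
Proof. exact: hcoef_binary_form. Qed.

Lemma polarize_linear : linear polarize.
Proof.
move=> a P Q; apply: (@sym_rep_eq m) => i im.
rewrite hcoef_polarize // [RHS]hcoefD hcoefZ !hcoef_polarize //.
by rewrite hcoefD hcoefZ mulrDr mulrCA.
Qed.
HB.instance Definition _ := GRing.isLinear.Build _ _ _ _ polarize polarize_linear.

Lemma polarize_borel : {in borel p, forall h (P : sym_rep p r),
  polarize (lact h P) = lact h (polarize P)}.
Proof.
move=> h Bh P; apply: (@sym_rep_eq m) => k km.
rewrite (hcoef_polarize _ km).
transitivity (char_d_exp p (r%:Z - m%:Z) h *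
    hcoef m k (mpoly_of_dhomog (polarize P) \mPo subst_GL h)); last first.
  by rewrite -hcoefZ.
rewrite (char_d_expE _ mr) (hcoef_borel Bh (dhomog_is_dhomog (polarize P)) km).
rewrite (hcoef_borel Bh (dhomog_is_dhomog P) (leq_trans km mr)).
rewrite !mulr_sumr; apply: eq_bigr => i _.
have ik : (i <= k)%N by rewrite -ltnS.
rewrite (hcoef_polarize _ (leq_trans ik km)).
have rk : (r - k = (r - m) + (m - k))%N by lia.
have := @bin_trinomial (r - i) (r - m) (k - i).
have -> : (r - i - (k - i) = r - k)%N by lia.
have -> : (r - i - (r - m) = m - i)%N by lia.
move=> /(_ ltac:(lia)) /(congr1 (fun n => n%:R : 'F_p)); rewrite !natrM => E.
rewrite {2}rk exprD; move: (hcoef r i _) => c.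
transitivity (('C(r - k, r - m)%:R * 'C(r - i, k - i)%:R) *
    (c * GLval h 0 0 ^+ i * GLval h 0 1 ^+ (k - i) *
      (GLval h 1 1 ^+ (r - m) * GLval h 1 1 ^+ (m - k)))); first by ring.
by rewrite E; ring.
Qed.

Lemma sym_quot_iso_polarize : (m < p)%N -> ((m + 1) * (p + 1) <= r + 1)%N ->
  ~~ (p %| 'C(r, m))%N ->
  lrep_iso (quot_rep (sym_theta p_prime r (m + 1))) (ind_rep sigma).
Proof.
move=> mp r_ge Crm.
have bin_neq0 i : (i <= m)%N -> 'C(r - i, r - m)%:R != 0 :> 'F_p.
  move=> im; rewrite natr_Fp_eq0 -bin_sub; last by rewrite leq_sub2l.
  by rewrite (_ : r - i - (r - m) = m - i)%N ?prime_ndvd_bin_sub //; lia.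
pose phi : {linear sym_rep p r -> sigma} := polarize.
apply: (@sym_quot_iso_ind p p_prime (m + 1) r sigma phi) => //.
- exact: polarize_borel.
- move=> P; rewrite addn1; split=> [P0 i|P0].
    rewrite ltnS => im; apply: (mulfI (bin_neq0 i im)).
    by rewrite mulr0 -hcoef_polarize // -[polarize P]/(phi P) P0 /hcoef mcoeff0.
  apply: (@sym_rep_eq m) => i im; rewrite [LHS]hcoef_polarize // P0 ?ltnS // mulr0.
  by rewrite /hcoef mcoeff0.
move=> w; pose w' : {mpoly 'F_p[2]} := mpoly_of_dhomog (w : sym_rep p m).
exists (DHomog (binary_form_homog r (fun i => hcoef m i w' / 'C(r - i, r - m)%:R))).
apply: (@sym_rep_eq m) => i im; rewrite [LHS]hcoef_polarize // hcoef_binary_form.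
  by rewrite mulrC divfK ?bin_neq0.
exact: leq_trans im mr.
Qed.
End Polarization.

Section SplitCase.
Variable r : nat.
Hypothesis r_gt0 : (0 < r)%N.
Local Notation sigma := (twist_rep (sym1_ss p) (char_d_exp p (r%:Z - 1))).

(** Modulo X^2, the substitution Y -> bX + dY sends Y^r to
    d^r Y^r + r b d^(r-1) X Y^(r-1). When p divides r the second term vanishes,
    and the two coefficients transform under B independently of each other. *)
Definition low_coefs (P : sym_rep p r) : sigma :=
  (hcoef r 1 (mpoly_of_dhomog P), hcoef r 0 (mpoly_of_dhomog P)).

Lemma low_coefs_linear : linear low_coefs.
Proof. by move=> a P Q; congr pair; rewrite /= hcoefD hcoefZ. Qed.
HB.instance Definition _ := GRing.isLinear.Build _ _ _ _ low_coefs low_coefs_linear.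

Lemma low_coefs_borel : (p %| r)%N -> {in borel p, forall h (P : sym_rep p r),
  low_coefs (lact h P) = lact h (low_coefs P)}.
Proof.
move=> pr h Bh P.
have dE : char_d_exp p (r%:Z - 1) h = GLval h 1 1 ^+ r.-1.
  by rewrite (char_d_expE h r_gt0) subn1.
have r0 : r%:R = 0 :> 'F_p by apply/eqP; rewrite natr_Fp_eq0.
have Ph := dhomog_is_dhomog P.
congr pair; rewrite -/(char_d_exp p (r%:Z - 1)) dE.
  rewrite [LHS](hcoef_borel Bh Ph r_gt0) big_ord_recr big_ord1 /=.
  rewrite !subn0 bin1 r0 subnn bin0 expr0 expr1 subn1.
  rewrite -[RHS]/(GLval h 1 1 ^+ r.-1 * (GLval h 0 0 * hcoef r 1 (mpoly_of_dhomog P))).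
  by ring.
rewrite [LHS](hcoef_borel Bh Ph (leq0n r)) big_ord1 /= bin0 !expr0 subn0.
rewrite -[RHS]/(GLval h 1 1 ^+ r.-1 * (GLval h 1 1 * hcoef r 0 (mpoly_of_dhomog P))).
have -> : GLval h 1 1 ^+ r = GLval h 1 1 ^+ r.-1 * GLval h 1 1.
  by rewrite -exprSr (prednK r_gt0).
by rewrite !mul1r mulrC mulrA.
Qed.

Lemma sym_quot_iso_split : (2 * (p + 1) <= r + 1)%N -> (p %| r)%N ->
  lrep_iso (quot_rep (sym_theta p_prime r 2)) (ind_rep sigma).
Proof.
move=> r_ge pr.
pose phi : {linear sym_rep p r -> sigma} := low_coefs.
apply: (@sym_quot_iso_ind p p_prime 2 r sigma phi) => //.
- exact: low_coefs_borel.
- move=> P; split=> [[P1 P0] [|[|//]] _|P0]; [exact: P0 | exact: P1 |].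
  by congr pair; exact: P0.
case=> u v; exists (DHomog (binary_form_homog r (fun i => if i == 0 then v else u))).
by congr pair; rewrite hcoef_binary_form.
Qed.
End SplitCase.
End Cases.

Theorem theorem1p1 (p m r : nat) (p_prime : prime p)
    (m_le : (0 <= m <= p - 1)%N)
    (r_ge : ((m + 1) * (p + 1) - 1 <= r)%N) :
  (~~ (p %| 'C(r, m))%N ->
     lrep_iso
       (quot_rep (sym_theta p_prime r (m + 1)))
       (ind_rep (twist_rep (sym_borel p m) (char_d_exp p (r%:Z - m%:Z)))))
  /\
  ((p %| 'C(r, m))%N -> m = 1%N ->
     lrep_iso
       (quot_rep (sym_theta p_prime r 2))
       (ind_rep (twist_rep (sym1_ss p) (char_d_exp p (r%:Z - 1))))).
Proof.
have p_gt1 := prime_gt1 p_prime.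
have mr : (m <= r)%N by nia.
split=> [|+ m1]; first by apply: sym_quot_iso_polarize => //; lia.
by rewrite m1 bin1; apply: sym_quot_iso_split; lia.
Qed.
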